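(* Let $d\in\mathbb{N}$ with $d\geq 4$, and let $D$ be a digraph with $\delta^+(D)\geq d$. Let $\tau$ be the set comprising (1) $(A,B)$ for all proper separations $\{A,B\}$ of $D$ of order $<d/4$ such that no edge crosses from $B$ to $A$, and (2) $(A,V(D))$ for all $A\subseteq V(D)$ of size $<d/4$. If $D$ does not contain two vertex-disjoint subdigraphs of minimum out-degree $\geq d/4$, then $\tau$ is a $(d/4)$-tangle in $D$.
   Context: $\mathbb{N}=\{1,2,3,\ldots\}$. All digraphs (and subdigraphs) are finite, non-empty and simple (no loops, no parallel edges in the same direction), but anti-parallel pairs of edges are allowed. $\delta^+(D)=\min_{v\in V(D)} d_D^+(v)$ denotes the minimum out-degree. For $A,B\subseteq V(D)$, an edge of $D$ crosses from $A$ to $B$ if its startpoint is in $A\setminus B$ and its endpoint is in $B\setminus A$. A (directed) separation of $D$ is an unordered pair $\{A,B\}$ of subsets of $V(D)$ such that $A\cup B=V(D)$ and either no edge of $D$ crosses from $A$ to $B$ or no edge of $D$ crosses from $B$ to $A$. It is proper if neither $A$ nor $B$ equals $V(D)$. Its order is $|A\cap B|$. The orientations of $\{A,B\}$ are the oriented separations $(A,B)$ and $(B,A)$. A set $\tau$ of oriented separations of $D$ of order $<k$ is a $k$-tangle in $D$ if (T1) for all separations $\{A,B\}$ of $D$ of order $<k$, we have $(A,B)\in\tau$ or $(B,A)\in\tau$; and (T2) if $(A_1,B_1),(A_2,B_2),(A_3,B_3)\in\tau$ (not necessarily distinct), then $A_1\cup A_2\cup A_3\neq V(D)$. This definition is used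 verbatim also when $k$ is a positive rational number such as $d/4$. *)

(* Defs.v *)
From HB Require Import structures.
From mathcomp Require Import all_boot all_order all_algebra.

Set Implicit Arguments.
Unset Strict Implicit.
Unset Printing Implicit Defensive.

Import Order.TTheory GRing.Theory Num.Theory.

Local Open Scope ring_scope.

(** A digraph carries its vertex set inside an ambient finite type [T], so that
    subdigraphs (which may drop vertices and edges) are digraphs over the same
    [T].  An edge [(u, v)] starts at [u] and ends at [v]. *)
Record digraph (T : finType) := Digraph {
  vertices : {set T};
  edges : {set T * T};
  vertices_neq0 : vertices != set0;
  edges_vertices : edges \subset setX vertices vertices;
  edges_irrefl : forall v, (v, v) \notin edges
}.

Section Digraphs.
Variable T : finType.
Implicit Types (D H : digraph T) (A B : {set T}) (k : rat).

Definition subdigraph H D : bool :=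
  (vertices H \subset vertices D) && (edges H \subset edges D).

Definition outdeg D (v : T) : nat := #|[set w | (v, w) \in edges D]|.

(** The default [#|vertices D|] never matters: there is at least one vertex, and
    every out-degree is smaller than [#|vertices D|]. *)
Definition min_outdeg D : nat :=
  \big[minn/#|vertices D|]_(v in vertices D) outdeg D v.

Definition crosses D A B (e : T * T) : bool :=
  [&& e \in edges D, e.1 \in A :\: B & e.2 \in B :\: A].

Definition no_crossing D A B : bool := [forall e, ~~ crosses D A B e].

(** This is symmetric in [A] and [B]: it is a property of the unordered pair
    [{A, B}].  The oriented separation [(A, B)] is the ordered pair. *)
Definition separation D A B : bool :=
  (A :|: B == vertices D) && (no_crossing D A B || no_crossing D B A).

Definition proper_sep D A B : bool :=
  (A != vertices D) && (B != vertices D).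

Definition sep_order A B : nat := #|A :&: B|.

Definition tangle k D (tau : {set {set T} * {set T}}) : Prop :=
  [/\ forall A B, (A, B) \in tau ->
        separation D A B /\ (sep_order A B)%:R < k,
      forall A B, separation D A B -> (sep_order A B)%:R < k ->
        (A, B) \in tau \/ (B, A) \in tau
    & forall A1 B1 A2 B2 A3 B3,
        (A1, B1) \in tau -> (A2, B2) \in tau -> (A3, B3) \in tau ->
        A1 :|: A2 :|: A3 <> vertices D].

Definition edge_orientation k D : {set {set T} * {set T}} :=
  [set p | [&& separation D p.1 p.2, proper_sep D p.1 p.2,
               (sep_order p.1 p.2)%:R < k & no_crossing D p.2 p.1]]
  :|: [set (A, vertices D) | A : {set T}
        & (A \subset vertices D) && (#|A|%:R < k)].

End Digraphs.

(* Main.v *)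
Require Import Defs.
From mathcomp Require Import all_boot all_order all_algebra.
From mathcomp Require Import zify.

Set Implicit Arguments.
Unset Strict Implicit.
Unset Printing Implicit Defensive.

Import Order.TTheory GRing.Theory Num.Theory.

Local Open Scope ring_scope.

(** For an oriented separation [(A, B)] of the orientation, the set
    [V(D) \ A] is non-empty and its out-neighbours lie in itself or in the small
    set [A :&: B].  If [A1], [A2], [A3] cover [V(D)], then the complements
    [C1], [C2], [C3] have empty intersection.  Either [C1] and [C2] are disjoint,
    or [C1 :&: C2] and [C3] are; in both cases only fewer than [d / 2]
    out-neighbours of each vertex are lost, so the two disjoint sets induce
    subdigraphs of minimum out-degree at least [d / 4]. *)

Section OutClosed.
Variables (T : finType) (D : digraph T).
Implicit Types (X S : {set T}).

Definition out_closed X S : Prop :=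
  forall v w, v \in X -> (v, w) \in edges D -> w \in X :|: S.

(** An edge that leaves [X1 :&: X2] leaves [X1] or [X2], so it ends in [S1] or [S2]. *)
Lemma out_closedI X1 S1 X2 S2 :
  out_closed X1 S1 -> out_closed X2 S2 -> out_closed (X1 :&: X2) (S1 :|: S2).
Proof.
move=> c1 c2 v w /setIP[v1 v2] vw.
move: (c1 v w v1 vw) (c2 v w v2 vw); rewrite !inE.
by do 4!case: (_ \in _).
Qed.

Lemma min_outdeg_geP (n : nat) :
  reflect (forall v, v \in vertices D -> (n <= outdeg D v)%N)
          (n <= min_outdeg D)%N.
Proof.
apply: (iffP idP) => [le_n v vD | le_n].
  apply: leq_trans le_n _; rewrite /min_outdeg.
  elim: (index_enum T) (mem_index_enum v) => // u r IHr.
  rewrite inE big_cons => /predU1P[<-|/IHr le_r]; first by rewrite vD geq_minl.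
  by case: ifP => // _; apply: leq_trans (geq_minr _ _) le_r.
(* The default value of the minimum must be at least [n] too: the out-neighbours of [v0] are at
   least [n] vertices of [D]. *)
have [v0 v0D] := set0Pn _ (vertices_neq0 D).
rewrite /min_outdeg; elim/big_ind: _ => [|x y nx ny|//].
  apply: leq_trans (le_n v0 v0D) _; apply/subset_leq_card/subsetP => w.
  by rewrite inE => /(subsetP (edges_vertices D)); rewrite inE => /andP[].
by rewrite leq_min nx.
Qed.

Lemma min_outdeg_le_card : (min_outdeg D <= #|vertices D|)%N.
Proof.
have [v vD] := set0Pn _ (vertices_neq0 D).
have := elimT (min_outdeg_geP _) (leqnn _) v vD.
move/leq_trans; apply; apply/subset_leq_card/subsetP => w.
by rewrite inE => /(subsetP (edges_vertices D)); rewrite inE => /andP[].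
Qed.

End OutClosed.

Section Induced.
Variables (T : finType) (D : digraph T) (X : {set T}).
Hypothesis X_neq0 : X != set0.

Let induced_edges : {set T * T} := edges D :&: setX X X.

Fact induced_edges_vertices : induced_edges \subset setX X X.
Proof. exact: subsetIr. Qed.

Fact induced_edges_irrefl v : (v, v) \notin induced_edges.
Proof. by rewrite inE (negbTE (edges_irrefl D v)). Qed.

Definition induced : digraph T :=
  Digraph X_neq0 induced_edges_vertices induced_edges_irrefl.

Lemma induced_subdigraph : X \subset vertices D -> subdigraph induced D.
Proof. by move=> sXD; rewrite /subdigraph sXD subsetIl. Qed.

(** An out-neighbour of a vertex of [X] is lost only if it lies outside [X], hence in [S]. *)
Lemma min_outdeg_induced (S : {set T}) :
  X \subset vertices D -> out_closed D X S ->
  (min_outdeg D - #|S| <= min_outdeg induced)%N.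
Proof.
move=> sXD cX; apply/min_outdeg_geP => v vX; rewrite leq_subLR.
have := elimT (min_outdeg_geP _ _) (leqnn _) v (subsetP sXD v vX).
move/leq_trans; apply; apply: leq_trans (leq_card_setU _ _).
apply/subset_leq_card/subsetP => w; rewrite inE => vw.
by move: (cX v w vX vw); rewrite !inE vw /= [v \in X]vX orbC.
Qed.

End Induced.

Section Orientation.
Variables (T : finType) (D : digraph T).
Implicit Types (A B X S : {set T}).

Lemma no_crossing_vertices A : A \subset vertices D ->
  no_crossing D A (vertices D) /\ no_crossing D (vertices D) A.
Proof.
rewrite -setD_eq0 => /eqP A0.
by split; apply/forallP => e; rewrite /crosses A0 in_set0 ?andbF.
Qed.

(** A vertex of [D] outside [A] lies in [B :\: A], so its out-neighbours avoid [A :\: B]. *)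
Lemma no_crossing_out_closed A B :
  A :|: B = vertices D -> no_crossing D B A ->
  out_closed D (vertices D :\: A) (A :&: B).
Proof.
move=> defD /forallP nBA v w; rewrite inE => /andP[vA vD] vw.
have wD : w \in vertices D.
  by move: (subsetP (edges_vertices D) _ vw); rewrite inE => /andP[].
move: (nBA (v, w)); rewrite /crosses vw /= !inE wD.
move: vD wD; rewrite -defD !inE (negbTE vA) /= => ->.
by case: (w \in A); case: (w \in B).
Qed.

(** Unifies the two kinds of members: if [B = vertices D], then [A :&: B = A], so the bound on the
    size of [A] is a bound on the order. *)
Lemma edge_orientationP k A B :
  reflect (separation D A B /\ (sep_order A B)%:R < k /\
           (proper_sep D A B && no_crossing D B A \/ B = vertices D))
          ((A, B) \in edge_orientation k D).
Proof.
apply: (iffP setUP) => [[]|].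
- by rewrite inE /= => /and4P[-> -> -> ->]; split; last split; try left.
- case/imsetP => A'; rewrite inE => /andP[sA ltA] [-> ->].
  have [nAD _] := no_crossing_vertices sA.
  rewrite /separation /sep_order nAD (setUidPr sA) eqxx.
  by rewrite (setIidPl sA); split=> //; split=> //; right.
case=> sAB [ltAB [/andP[pAB nBA]|defB]].
  by left; rewrite inE /= sAB pAB ltAB nBA.
right; move: sAB ltAB; rewrite {}defB => /andP[/eqP/setUidPr sA _].
by rewrite /sep_order (setIidPl sA) => ltA; apply: imset_f; rewrite inE sA.
Qed.

Lemma edge_orientation_out_closed (k : rat) A B :
  k <= (min_outdeg D)%:R ->
  (A, B) \in edge_orientation k D ->
  [/\ vertices D :\: A != set0, out_closed D (vertices D :\: A) (A :&: B)
    & #|A :&: B|%:R < k].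
Proof.
move=> le_k /edge_orientationP[/andP[/eqP defD _] [ltk ori]].
have [nBA AneqD] : no_crossing D B A /\ A != vertices D.
  case: ori => [/andP[/andP[] //] | defB].
  have sA : A \subset vertices D by rewrite -defD subsetUl.
  rewrite defB; split; first by have [] := no_crossing_vertices sA.
  (* If [A] were all of [vertices D], the order would be the number of vertices, which is at least
     the minimum out-degree and so at least [k]. *)
  apply: contraTneq ltk => defA; rewrite /sep_order defA defB setIid -leNgt.
  by apply: le_trans le_k _; rewrite ler_nat min_outdeg_le_card.
split=> //; last exact: no_crossing_out_closed.
rewrite setD_eq0; apply: contra AneqD => sDA.
by rewrite eqEsubset sDA -defD subsetUl.
Qed.

End Orientation.

Theorem lemma4p2 (T : finType) (d : nat) (D : digraph T)
    (hd : (4 <= d)%N)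
    (hD : (d <= min_outdeg D)%N)
    (hdisj : ~ exists H1 H2 : digraph T,
        [/\ subdigraph H1 D, subdigraph H2 D,
            [disjoint vertices H1 & vertices H2],
            (d%:R / 4%:R : rat) <= (min_outdeg H1)%:R
          & (d%:R / 4%:R : rat) <= (min_outdeg H2)%:R]) :
  tangle (d%:R / 4%:R) D (edge_orientation (d%:R / 4%:R) D).
Proof.
have le_quarter n : ((d%:R / 4%:R : rat) <= n%:R) = (d <= n * 4)%N.
  by rewrite ler_pdivrMr ?ltr0n // -natrM ler_nat.
(* With [S] and [S'] of size at most [d / 2], out-degrees at least [d / 2], hence at least [d / 4],
   survive in both induced subdigraphs. *)
have no_disjoint X Y S S' : X != set0 -> Y != set0 ->
    X \subset vertices D -> Y \subset vertices D -> X :&: Y = set0 ->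
    out_closed D X S -> out_closed D Y S' ->
    (#|S| * 2 <= d)%N -> (#|S'| * 2 <= d)%N -> False.
  move=> X0 Y0 sX sY XY cX cY ltS ltS'; apply: hdisj.
  have := min_outdeg_induced X0 sX cX.
  have := min_outdeg_induced Y0 sY cY.
  exists (induced D X0), (induced D Y0); rewrite !le_quarter.
  by split; rewrite ?induced_subdigraph // -?setI_eq0 ?XY //; lia.
split=> [A B /edge_orientationP[? []] // | A B sAB ltAB |].
  (* (T1): a side equal to [vertices D] must come second; otherwise the separation is proper, and
     the direction without crossing edges decides. *)
  have [defA|nA] := eqVneq A (vertices D).
    right; apply/edge_orientationP; split; last split; try by right.
      by rewrite /separation setUC orbC.
    by rewrite /sep_order setIC.
  have [defB|nB] := eqVneq B (vertices D).
    by left; apply/edge_orientationP; split; last split; try right.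
  have := sAB; rewrite {1}/separation => /andP[_ /orP[nAB|nBA]].
    right; apply/edge_orientationP; split; last split.
    + by rewrite /separation setUC orbC.
    + by rewrite /sep_order setIC.
    + by left; rewrite /proper_sep nA nB.
  left; apply/edge_orientationP; split; last split; try by [].
  by left; rewrite /proper_sep nA nB.
move=> A1 B1 A2 B2 A3 B3.
have le_k : (d%:R / 4%:R : rat) <= (min_outdeg D)%:R by rewrite le_quarter; lia.
move=> /(edge_orientation_out_closed le_k)[C1 c1 lt1].
move=> /(edge_orientation_out_closed le_k)[C2 c2 lt2].
move=> /(edge_orientation_out_closed le_k)[C3 c3 lt3] cover.
move: lt1 lt2 lt3; rewrite !ltNge !le_quarter -!ltnNge => lt1 lt2 lt3.
have [C12|C12] := eqVneq ((vertices D :\: A1) :&: (vertices D :\: A2)) set0.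
  by apply: no_disjoint C1 C2 _ _ C12 c1 c2 _ _; rewrite ?subsetDl //; lia.
apply: no_disjoint C12 C3 _ _ _ (out_closedI c1 c2) c3 _ _.
- by rewrite subIset // subsetDl.
- exact: subsetDl.
- by rewrite -!setDUr cover setDv.
(* Two separators of fewer than [d / 4] vertices each have a union of fewer than [d / 2]. *)
- have [le_card _] := leq_card_setU (A1 :&: B1) (A2 :&: B2).
  by move: le_card; move: #|_ :|: _| => n; lia.
- lia.
Qed.
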